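(* Let $q\ge 3$ be a prime power. Then there exists a bipartite $$egr\bigl(2(q^4-q^3+q^2),\, q^2-q,\, 6,\, (q^2-q-1)(q^4-3q^3-q^2+5q+3)\bigr).$$
   Context: All graphs are simple, finite and connected. A $(k,g)$-graph is a $k$-regular graph of girth $g$. An edge-girth-regular graph $egr(n,k,g,\lambda)$ is a $(k,g)$-graph on $n$ vertices in which every edge is contained in exactly $\lambda$ distinct cycles of length $g$. Throughout, the valency $k$ is assumed to satisfy $k>2$. *)

(* Defs.v *)
From HB Require Import structures.
From mathcomp Require Import all_boot all_order all_algebra.
Set Implicit Arguments.
Unset Strict Implicit.
Unset Printing Implicit Defensive.

(* Graphs are given by an adjacency relation on a finite type of vertices.    *)

Definition prime_power (q : nat) : Prop :=
  exists p m : nat, [/\ prime p, 0 < m & q = p ^ m].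

Definition simple_graph (T : finType) (e : rel T) : Prop :=
  symmetric e /\ irreflexive e.

Definition connected_graph (T : finType) (e : rel T) : Prop :=
  forall x y : T, connect e x y.

Definition regular_graph (T : finType) (e : rel T) (k : nat) : Prop :=
  forall x : T, #|[set y | e x y]| = k.

Definition bipartite_graph (T : finType) (e : rel T) : Prop :=
  exists A : {set T}, forall x y : T, e x y -> (x \in A) != (y \in A).

(* ucycleb also accepts sequences of size at most 2 (an edge traversed back   *)
(* and forth, for instance), which are not cycles of a simple graph.          *)
Definition is_cycle (T : finType) (e : rel T) (s : seq T) : bool :=
  (2 < size s) && ucycleb e s.

Definition has_girth (T : finType) (e : rel T) (g : nat) : Prop :=
  (exists2 s : seq T, is_cycle e s & size s = g) /\
  (forall s : seq T, is_cycle e s -> g <= size s).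

Definition cycle_edges (T : finType) (s : seq T) : {set {set T}} :=
  [set [set x; next s x] | x in s].

(* Cycles are subgraphs, identified with their edge sets, so that the 2 * g   *)
(* vertex sequences that differ by starting point and direction count once.   *)
Definition cycles_of_length (T : finType) (e : rel T) (g : nat) :
    {set {set {set T}}} :=
  [set cycle_edges s | s : g.-tuple T & is_cycle e s].

Definition is_egr (T : finType) (e : rel T) (n k g lambda : nat) : Prop :=
  [/\ simple_graph e, connected_graph e & #|T| = n] /\
  [/\ 2 < k, regular_graph e k, has_girth e g &
      forall x y : T, e x y ->
        #|[set C in cycles_of_length e g | [set x; y] \in C]| = lambda].

(* Main.v *)
Require Import Defs.
From HB Require Import structures.
From mathcomp Require Import all_boot all_order all_algebra all_field.
From mathcomp Require Import zify ring.
Set Implicit Arguments.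
Unset Strict Implicit.
Unset Printing Implicit Defensive.

(* Take the projective plane of order q^2 with the unitary polarity given by a
   nondegenerate Hermitian form, remove the q^3 + 1 points of its Hermitian
   unital and their tangent lines, and keep the incidence graph of the remaining
   points and (secant) lines. Identifying a line with its pole, this is the
   bipartite double of the orthogonality relation on the nonabsolute points.
   A 6-cycle is a triangle of the plane whose vertices and sides all survive. For
   a flag (x, polar of y) and a second vertex x2 on that line, the two other sides
   range over (q^2 - q - 1)^2 pairs of secants through x and x2; the pairs to be
   discarded meet in a point u of the unital, and such u are the points of the
   unital off the polars of x, x2 and y, of which there are
   q^3 + 1 - 3(q + 1) since no absolute point lies on two of these polars. *)

(** * Two counting tools: fibres of a map and dependent pairs *)

(** The fibre sizes add up to [#|D|], so a uniform upper bound [n] whose total is at most [#|D|] is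
    attained on every fibre. This turns bounds on numbers of roots into exact counts of trace and
    norm fibres. *)
Lemma card_fiber_eq (A B : finType) (D : {set A}) (E : {set B}) (f : A -> B) n :
    (forall a, a \in D -> f a \in E) -> #|E| * n <= #|D| ->
    (forall b, b \in E -> #|[set a in D | f a == b]| <= n) ->
  forall b, b \in E -> #|[set a in D | f a == b]| = n.
Proof.
move=> fE cardD le_n.
have EcardD : #|D| = \sum_(c in E) #|[set a in D | f a == c]|.
  rewrite -sum1_card (partition_big f (mem E)) //=; apply: eq_bigr => c _.
  by rewrite -sum1_card; apply: eq_bigl => a; rewrite !inE.
have leifn b : b \in E -> #|[set a in D | f a == b]| <= n
    ?= iff (#|[set a in D | f a == b]| == n).
  by move=> /le_n.
have [le eqn] := leqif_sum leifn.
move: eqn; rewrite -EcardD sum_nat_const eqn_leq cardD -(sum_nat_const (mem E)).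
rewrite EcardD le => /esym/forall_inP eqn b Eb; exact/eqP/eqn.
Qed.

Lemma card_dep_pairs (A B : finType) (D : {set A}) (E : A -> {set B}) n :
    (forall a, a \in D -> #|E a| = n) ->
  #|[set t : A * B | (t.1 \in D) && (t.2 \in E t.1)]| = #|D| * n.
Proof.
move=> En; rewrite -sum_nat_const -sum1dep_card.
rewrite -(pair_big_dep (mem D) (fun a b => b \in E a) (fun _ _ => 1)) /=.
by apply: eq_bigr => a /En <-; rewrite sum1_card.
Qed.

(** * Cycles through an edge, counted as vertex sequences *)

Section CyclesThroughEdge.

Variables (T : finType) (e : rel T).
Hypothesis e_sym : symmetric e.

Lemma eq_set2 (a b c d : T) :
  [set a; b] = [set c; d] -> (a = c /\ b = d) \/ (a = d /\ b = c).
Proof.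
move=> E.
have := set21 a b; have := set22 a b; rewrite E !inE.
have := set21 c d; have := set22 c d; rewrite -E !inE.
by do 4![case/orP=> /eqP ?]; subst; auto.
Qed.

Lemma cycle_edgesP (s : seq T) (a b : T) : uniq s ->
  reflect (a \in s /\ (b = next s a \/ b = prev s a))
          ([set a; b] \in cycle_edges s).
Proof.
move=> Us; apply: (iffP imsetP) => [[x xs /eq_set2[[-> ->]|[-> ->]]]|[as_ []->]].
- by split=> //; left.
- by rewrite mem_next prev_next //; split=> //; right.
- by exists a.
- by exists (prev s a); rewrite ?mem_prev // next_prev // setUC.
Qed.

Lemma cycle_edges_rot n (s : seq T) :
  uniq s -> cycle_edges (rot n s) = cycle_edges s.
Proof.
move=> Us; apply/setP=> A; apply/imsetP/imsetP=> -[x]; rewrite ?mem_rot => xs ->.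
  by exists x => //; rewrite next_rot.
by exists x; rewrite ?mem_rot // next_rot.
Qed.

Lemma cycle_edges_rev (s : seq T) :
  uniq s -> cycle_edges (rev s) = cycle_edges s.
Proof.
move=> Us; apply/setP=> A; apply/imsetP/imsetP=> -[x]; rewrite ?mem_rev => xs ->.
  by exists (prev s x); rewrite ?mem_prev // next_prev // next_rev // setUC.
by exists (next s x); rewrite ?mem_rev ?mem_next // next_rev // prev_next // setUC.
Qed.

Lemma is_cycle_rot n (s : seq T) : is_cycle e (rot n s) = is_cycle e s.
Proof. by rewrite /is_cycle /ucycleb size_rot rot_cycle rot_uniq. Qed.

Lemma is_cycle_rev (s : seq T) : is_cycle e (rev s) = is_cycle e s.
Proof.
rewrite /is_cycle /ucycleb size_rev rev_cycle rev_uniq.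
by congr [&& _, _ & _]; apply: eq_cycle => x y; rewrite e_sym.
Qed.

Lemma next_next_neq (s : seq T) x :
  uniq s -> 2 < size s -> x \in s -> next s (next s x) != x.
Proof.
move=> Us s3 /rot_to[i s' Es]; rewrite -!(next_rot i Us) Es.
move: Us s3; rewrite -(rot_uniq i) -(size_rot i) Es.
case: s' {Es} => [|y [|z s']] //= /andP[]; rewrite !inE !negb_or.
case/and3P=> nxy nxz _ _ _.
by rewrite eqxx (eq_sym y) (negbTE nxy) eqxx eq_sym.
Qed.

(** The edge set determines the vertices one after another: the edge leaving [y] in the first cycle
    is an edge of the second one at [y], and it cannot lead back to the predecessor of [y], as the
    cycle has more than two vertices. *)
Lemma cycle_edges_inj (v : T) (s t : seq T) :
    is_cycle e (v :: s) -> is_cycle e (v :: t) -> size s = size t ->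
    next (v :: s) v = next (v :: t) v ->
  cycle_edges (v :: s) = cycle_edges (v :: t) -> s = t.
Proof.
case/and3P=> s3 _ Us /and3P[t3 _ Ut] Est nst Eedges.
have E i : iter i (next (v :: s)) v = iter i (next (v :: t)) v /\
    iter i (next (v :: s)) v \in v :: s.
  elim/ltn_ind: i => -[|[|i]] IH; rewrite ?mem_head //.
    by split; [exact: nst | rewrite iterS mem_next mem_head].
  have [E0 m0] := IH i (ltnW (ltnSn _)); have [E1 m1] := IH i.+1 (ltnSn _).
  split; last by rewrite !iterS !mem_next.
  move: E1 m1; rewrite !iterS -E0; move: (iter i _ v) m0 => x xs Ex _.
  rewrite -Ex.
  set y := next (v :: s) x in Ex *.
  have ys : y \in v :: s by rewrite mem_next.
  have : [set y; next (v :: s) y] \in cycle_edges (v :: t).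
    by rewrite -Eedges; apply/(cycle_edgesP _ _ Us); split=> //; left.
  case/(cycle_edgesP _ _ Ut)=> yt [] //.
  have -> : prev (v :: t) y = x by rewrite Ex prev_next.
  by move/eqP; rewrite (negbTE (next_next_neq Us s3 xs)).
(* Both sequences are trajectories of their [next] functions, so agreement of all iterates gives
   equality. *)
have := fpathE (cycle_next Us); have := fpathE (cycle_next Ut).
rewrite !size_rcons -Est => Ft Fs.
have : rcons s v = rcons t v.
  rewrite Fs Ft -nst; set w := next _ v.
  apply: (@eq_from_nth _ w); rewrite !size_traject // => i lti.
  by rewrite !nth_traject // {2}/w nst -!iterSr; case: (E i.+1).
by case/rcons_inj.
Qed.

(** Among the [2 * g.+2] sequences that describe one cycle through the edge, exactly one starts with
    [v] followed by [w]. *)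
Lemma card_cycles_through_edge g (v w : T) :
  #|[set C in cycles_of_length e g.+2 | [set v; w] \in C]| =
  #|[set s : g.+2.-tuple T | [&& is_cycle e s, nth v s 0 == v & nth v s 1 == w]]|.
Proof.
rewrite -(card_in_imset (f := fun s : g.+2.-tuple T => cycle_edges s)); last first.
  move=> [[|a [|b s]] //= ss] [[|c [|d t]] //= st]; rewrite !inE /=.
  case/and3P=> Cs /eqP Ea /eqP Eb /and3P[Ct /eqP Ec /eqP Ed]; subst => E.
  have Est : size (w :: s) = size (w :: t) by case/eqP: ss; case/eqP: st => /= -> ->.
  apply: val_inj => /=; rewrite (cycle_edges_inj Cs Ct Est _ E) //=.
  by rewrite !eqxx.
apply: eq_card => C; rewrite !inE; apply/andP/imsetP; last first.
  case=> s; rewrite inE => /and3P[Cs /eqP s0 /eqP s1] ->.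
  split; first by apply: imset_f; rewrite inE.
  case/and3P: Cs => s3 _ Us; case: s s0 s1 s3 Us => -[|a [|b s]] //= _ -> -> _ Us.
  apply/(@cycle_edgesP [:: v, w & s] _ _ Us); rewrite mem_head; split=> //; left.
  by rewrite /= eqxx.
case=> /imsetP[s Cs ->]; rewrite inE in Cs.
have Us : uniq s by case/and3P: Cs.
case/(cycle_edgesP _ _ Us)=> vs.
(* The orientation is chosen so that [w] follows [v]; a rotation then brings [v] to the front. *)
pose t := if w == next s v then (s : seq T) else rev s.
move=> wnp.
have Ut : uniq t by rewrite /t; case: ifP; rewrite ?rev_uniq.
have Ct : is_cycle e t by rewrite /t; case: ifP; rewrite ?is_cycle_rev.
have vt : v \in t by rewrite /t; case: ifP; rewrite ?mem_rev.
have st : size t = g.+2 by rewrite /t; case: ifP; rewrite ?size_rev size_tuple.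
have Et : cycle_edges s = cycle_edges t.
  by rewrite /t; case: ifP; rewrite // cycle_edges_rev.
have wt : next t v = w.
  by rewrite /t; case: eqP => [-> // | nw]; rewrite next_rev //; case: wnp.
have [i t' rt] := rot_to vt.
have st' : size (rot i t) == g.+2 by rewrite size_rot st.
exists (Tuple st'); last by rewrite /= cycle_edges_rot.
rewrite inE /= is_cycle_rot Ct /=.
move: st' wt; rewrite -(next_rot i Ut) rt; case: t' {rt} => //= b t' _.
by rewrite !eqxx => ->; rewrite eqxx.
Qed.

End CyclesThroughEdge.

(** * Counting in a plane of order q^2 with an abstract unitary polarity *)

Section UnitaryPolarity.

Variables (q : nat) (P : finType) (perp : rel P).
Hypothesis q_ge3 : 3 <= q.
Hypothesis perp_sym : symmetric perp.
Hypothesis pole_exists : forall x y, exists z, perp x z /\ perp y z.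
Hypothesis pole_uniq : forall x y z w,
  x != y -> perp x z -> perp y z -> perp x w -> perp y w -> z = w.
Hypothesis tangent_uniq : forall u v,
  perp u u -> perp v v -> perp u v -> u = v.
Hypothesis card_polar : forall x, #|[set y | perp x y]| = q ^ 2 + 1.
Hypothesis card_absolute_polar : forall x,
  ~~ perp x x -> #|[set u | perp x u & perp u u]| = q + 1.
Hypothesis card_points : #|P| = q ^ 4 + q ^ 2 + 1.
Hypothesis card_absolute : #|[set u | perp u u]| = q ^ 3 + 1.

(** For distinct points, the intersection of their polars, that is, the pole of the line joining
    them. The default [x] makes the function total. *)
Definition pole x y := odflt x [pick z | perp x z && perp y z].

Lemma poleP x y : perp x (pole x y) /\ perp y (pole x y).
Proof.
rewrite /pole; case: pickP => [z /andP[] // | none].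
by have [z [xz yz]] := pole_exists x y; have := none z; rewrite xz yz.
Qed.

Lemma poleE x y z : x != y -> perp x z -> perp y z -> pole x y = z.
Proof. by move=> nxy xz yz; have [] := poleP x y => *; apply: (pole_uniq nxy). Qed.

Definition nbr x := [set y | perp x y & ~~ perp y y].

Lemma card_nonabsolute_polar x : ~~ perp x x -> #|nbr x| = q ^ 2 - q.
Proof.
move=> nx; have := cardsID [set u | perp u u] [set y | perp x y].
have -> : [set y | perp x y] :&: [set u | perp u u] = [set u | perp x u & perp u u].
  by apply/setP=> y; rewrite !inE.
have -> : [set y | perp x y] :\: [set u | perp u u] = nbr x.
  by apply/setP=> y; rewrite !inE andbC.
by rewrite card_polar card_absolute_polar //; lia.
Qed.

(** Otherwise [x] and [u] would both be the intersection of the polars of [u] and [y], hence equal,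
    although only [u] is absolute. *)
Lemma no_absolute_triangle u x y :
  perp u u -> ~~ perp x x -> ~~ perp y y -> perp x y -> perp x u -> ~~ perp y u.
Proof.
move=> uu nx ny xy xu; apply/negP=> yu.
have nuy : u != y by apply: contraNneq ny => <-.
have E : u = x.
  by apply: (pole_uniq nuy) => //; rewrite perp_sym.
by move: nx; rewrite -E uu.
Qed.

Lemma card_absolute_off_triangle x x2 y :
    ~~ perp x x -> ~~ perp x2 x2 -> ~~ perp y y -> x != x2 ->
    perp x y -> perp x2 y ->
  #|[set u | [&& perp u u, ~~ perp y u, ~~ perp x u & ~~ perp x2 u]]| =
  q ^ 3 - 3 * q - 2.
Proof.
move=> nx nx2 ny nxx2 xy x2y.
pose A z := [set u | perp z u & perp u u].
have dis : [/\ [disjoint A x & A x2], [disjoint A x & A y] & [disjoint A x2 & A y]].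
  split; rewrite disjoints_subset; apply/subsetP=> u; rewrite !inE => /andP[xu uu];
    rewrite uu andbT.
  (* The polars of [x] and [x2] meet only in [y], which is not absolute. *)
  - apply/negP=> x2u; move: ny.
    by rewrite -(pole_uniq nxx2 xu x2u xy x2y) uu.
  - exact: (no_absolute_triangle uu nx ny).
  - exact: (no_absolute_triangle uu nx2 ny).
have := cardsID (A x :|: A x2 :|: A y) [set u | perp u u].
have -> : [set u | perp u u] :&: (A x :|: A x2 :|: A y) = A x :|: A x2 :|: A y.
  by apply/setP=> u; rewrite !inE; case: (perp u u); rewrite ?andbF ?andbT.
have -> : [set u | perp u u] :\: (A x :|: A x2 :|: A y) =
    [set u | [&& perp u u, ~~ perp y u, ~~ perp x u & ~~ perp x2 u]].
  apply/setP=> u; rewrite !inE; case: (perp u u); rewrite ?andbF ?andbT //=.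
  by rewrite !negb_or andbC andbA.
case: dis => d1 d2 d3.
have /eqP-> : #|A x :|: A x2 :|: A y| == #|A x :|: A x2| + #|A y|.
  by rewrite (leq_card_setU _ _) -setI_eq0 setIUl setU_eq0 !setI_eq0 d2.
have /eqP-> : #|A x :|: A x2| == #|A x| + #|A x2| by rewrite (leq_card_setU _ _).
by rewrite !card_absolute_polar // card_absolute; lia.
Qed.

(* Opposite sides of the hexagon through x, y, x2 meet in a point of the unital
   exactly when they join that point to x and to x2. *)
Lemma card_absolute_meet x x2 y :
    ~~ perp x x -> ~~ perp x2 x2 -> ~~ perp y y -> x != x2 ->
    perp x y -> perp x2 y ->
  #|[set p in setX (nbr x2 :\ y) (nbr x :\ y) |
       perp (pole p.1 p.2) (pole p.1 p.2)]| = q ^ 3 - 3 * q - 2.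
Proof.
move=> nx nx2 ny nxx2 xy x2y.
rewrite -(card_absolute_off_triangle nx nx2 ny nxx2 xy x2y).
set U : {set P} := [set u | _]; pose f u := (pole u x2, pole u x).
have fK u : u \in U -> pole (f u).1 (f u).2 = u.
  rewrite inE => /and4P[uu nyu _ _] /=.
  have [u3 x23] := poleP u x2; have [u5 x5] := poleP u x.
  apply: poleE; rewrite 1?perp_sym //; apply/eqP=> E35; move: nyu.
  by rewrite (pole_uniq nxx2 xy x2y x5) -?E35 // perp_sym u3.
have inj_f : {in U &, injective f}.
  by move=> u v Uu Uv E; rewrite -(fK u Uu) -(fK v Uv) E.
rewrite -(card_in_imset inj_f); apply: eq_card => -[y3 y5].
rewrite !inE /=; apply/idP/imsetP=> [|[u Uu [-> ->]]].
  case/andP=> /andP[/and3P[n3 p3 a3] /and3P[n5 p5 a5]] uu.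
  have n35 : y3 != y5.
    apply: contraNneq n5 => E; rewrite E in p3.
    by apply/eqP; apply: (pole_uniq nxx2).
  have [u3 u5] := poleP y3 y5; set u := pole y3 y5 in uu u3 u5 *.
  have xu : ~~ perp x u by apply: (no_absolute_triangle uu a5); rewrite // perp_sym.
  have x2u : ~~ perp x2 u by apply: (no_absolute_triangle uu a3); rewrite // perp_sym.
  have nu2 : u != x2 by apply: contraNneq nx2 => <-.
  have nu1 : u != x by apply: contraNneq nx => <-.
  exists u.
    rewrite inE uu xu x2u !andbT /=; apply: contraNN n3 => yu.
    by apply/eqP; apply: (pole_uniq nu2); rewrite // perp_sym.
  by rewrite /f; congr (_, _); apply/esym/poleE; rewrite // perp_sym.
have := fK u Uu; move: Uu; rewrite inE => /and4P[uu nyu nxu nx2u] /= ->.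
have [u3 x23] := poleP u x2; have [u5 x5] := poleP u x.
rewrite x23 x5 uu !andbT -andbA; apply/and4P; split.
- by apply: contraNneq nyu => <-; rewrite perp_sym.
(* If the pole of the side were absolute, the side would be the tangent at [u] and its pole would be
   [u] itself, which is off the polar of [x2]. *)
- by apply: contraNN nx2u => a3; rewrite (tangent_uniq uu a3 u3).
- by apply: contraNneq nyu => <-; rewrite perp_sym.
- by apply: contraNN nxu => a5; rewrite (tangent_uniq uu a5 u5).
Qed.

(** A triple [(x2, (y3, y5))] encodes the hexagon [x, y, x2, y3, x4, y5], where [x4] is forced to be
    [pole y3 y5]. *)
Definition hexagon_data x y := [set t : P * (P * P) | (t.1 \in nbr y :\ x) &&
  ((t.2 \in setX (nbr t.1 :\ y) (nbr x :\ y)) &&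
   ~~ perp (pole t.2.1 t.2.2) (pole t.2.1 t.2.2))].

Lemma card_hexagon_data x y : ~~ perp x x -> ~~ perp y y -> perp x y ->
  #|hexagon_data x y| =
  (q ^ 2 - q - 1) * ((q ^ 2 - q - 1) ^ 2 - (q ^ 3 - 3 * q - 2)).
Proof.
move=> nx ny xy.
have card_nbrD a b : ~~ perp a a -> ~~ perp b b -> perp a b ->
    #|nbr a :\ b| = q ^ 2 - q - 1.
  move=> na nb ab; have := cardsD1 b (nbr a).
  by rewrite card_nonabsolute_polar // inE ab nb /=; lia.
rewrite -(card_nbrD y x) 1?perp_sym //.
pose E a := [set p | (p \in setX (nbr a :\ y) (nbr x :\ y)) &&
  ~~ perp (pole p.1 p.2) (pole p.1 p.2)].
rewrite -(@card_dep_pairs _ _ (nbr y :\ x) E); last first.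
  move=> x2; rewrite !inE => /and3P[nx2x yx2 nx2].
  rewrite card_nbrD // 1?perp_sym //.
  have x2y : perp x2 y by rewrite perp_sym.
  have nxx2 : x != x2 by rewrite eq_sym.
  have := cardsID [set p | perp (pole p.1 p.2) (pole p.1 p.2)]
                  (setX (nbr x2 :\ y) (nbr x :\ y)).
  rewrite cardsX !card_nbrD // -setIdE card_absolute_meet //.
  have -> : setX (nbr x2 :\ y) (nbr x :\ y) :\:
      [set p | perp (pole p.1 p.2) (pole p.1 p.2)] = E x2.
    by apply/setP=> p; rewrite [in LHS]inE !in_set andbC.
  by lia.
by apply: eq_card => t; rewrite !in_set.
Qed.

(** * The incidence graph of nonabsolute points and secant lines *)

(** The Boolean separates points from lines, a line being represented by its pole. *)
Definition nonabsolute_graph : rel (bool * {x | ~~ perp x x}) :=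
  fun u v => (u.1 != v.1) && perp (val u.2) (val v.2).

Local Notation adj := nonabsolute_graph.

Lemma nonabsolute_graph_simple : simple_graph adj.
Proof.
split=> [u v|u]; first by rewrite /adj eq_sym perp_sym.
by rewrite /adj eqxx.
Qed.

Lemma nonabsolute_graph_bipartite : bipartite_graph adj.
Proof.
exists [set u | u.1] => u v /andP[]; rewrite !inE.
by case: u.1; case: v.1.
Qed.

Lemma nonabsolute_graph_card : #|{: bool * {x | ~~ perp x x}}| =
  2 * (q ^ 4 - q ^ 3 + q ^ 2).
Proof.
rewrite card_prod card_bool card_sig; congr (2 * _).
have := cardsC [set u | perp u u]; rewrite card_absolute card_points.
have -> : #|~: [set u | perp u u]| = #|[pred x | ~~ perp x x]|.
  by apply: eq_card => x; rewrite !inE.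
by have : q ^ 3 <= q ^ 4 by [rewrite leq_exp2l //; lia]; lia.
Qed.

Lemma nonabsolute_graph_regular : regular_graph adj (q ^ 2 - q).
Proof.
move=> [b x]; rewrite -(card_nonabsolute_polar (valP x)).
rewrite -(card_in_imset (f := fun v => val v.2)); last first.
  move=> [c y] [d z]; rewrite !inE => /andP[/= bc _] /andP[/= bd _] /val_inj ->.
  by case: b c d bc bd => -[] [].
apply: eq_card => y; rewrite inE; apply/imsetP/andP.
  case=> -[c z]; rewrite inE => /andP[/= _ xz] ->.
  by split; [| apply: (valP z)].
case=> xy ny; exists (~~ b, exist _ y ny) => //.
by rewrite inE /adj /=; case: (b).
Qed.

(** If every candidate [p] failed, [pole y] would map the q^2 - q nonabsolute points of the polar of
    [m] into the q + 1 absolute points of the polar of [y]. The map is injective because [y] is off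
    the polar of [m], and q^2 - q > q + 1 for q at least 3. *)
Lemma secant_path y m : ~~ perp y y -> ~~ perp m m -> ~~ perp y m ->
  exists2 p, perp m p && ~~ perp p p & ~~ perp (pole y p) (pole y p).
Proof.
move=> ny nm nym; apply/exists_inP; apply: contraT => /exists_inPn none.
have := card_absolute_polar ny; have := card_nonabsolute_polar nm.
have inj : {in nbr m &, injective (pole y)}.
  move=> p p'; rewrite !inE => /andP[mp np] /andP[mp' np'] E.
  have [yu pu] := poleP y p; have [_] := poleP y p'; rewrite -E => p'u.
  apply/eqP; apply: contraNT nym => npp'.
  by rewrite -(pole_uniq (w := m) npp' pu p'u) // perp_sym.
rewrite -(card_in_imset inj).
have /subset_leq_card : pole y @: nbr m \subset [set u | perp y u & perp u u].
  apply/subsetP=> z /imsetP[p mp ->]; rewrite !inE in mp *.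
  by rewrite (poleP y p).1; apply/negPn/none.
by move=> le Em Ey; move: le; rewrite Em Ey; nia.
Qed.

Lemma nonabsolute_graph_connected : connected_graph adj.
Proof.
(* Vertices on opposite sides are joined by a path of length 1 or 3; two vertices on the same side
   are joined through the other side. *)
have opposite b y m : connect adj (b, y) (~~ b, m).
  case: y m => y ny [m nm].
  have [ym | nym] := boolP (perp y m).
    by apply: connect1; rewrite /adj /= ym andbT; case: b.
  have [p /andP[mp np] nz] := secant_path ny nm nym.
  have [yz pz] := poleP y p; set z := pole y p in nz yz pz.
  apply: (connect_trans (y := (~~ b, exist _ z nz))).
    by apply: connect1; rewrite /adj /= yz andbT; case: b.
  apply: (connect_trans (y := (b, exist _ p np))); apply: connect1.
    by rewrite /adj /= perp_sym pz andbT; case: b.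
  by rewrite /adj /= perp_sym mp andbT; case: b.
move=> [b y] [c m]; have := opposite b y m.
have [->|ncb] := eqVneq c (~~ b) => // _.
have -> : c = ~~ ~~ b by case: b c ncb => -[].
exact: connect_trans (opposite b y m) (opposite (~~ b) m m).
Qed.

Lemma nonabsolute_graph_girth_ge s : is_cycle adj s -> 6 <= size s.
Proof.
(* A quadrangle would give two distinct points with two common polar points; cycles of length 3 and
   5 contradict the bipartition. *)
have quad (a b c d : bool * {x | ~~ perp x x}) :
    adj a b -> adj b c -> adj c d -> adj d a -> a != c -> b = d.
  case: a b c d => [a x] [b y] [c z] [d w].
  move=> /andP[/= ab xy] /andP[/= bc yz] /andP[/= cd zw] /andP[/= da wx] nac.
  have E : a = c /\ b = d by case: a b c d ab bc cd da nac => -[] [] [].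
  case: E => ??; subst c d; congr (_, _); apply: val_inj.
  apply: (pole_uniq (x := val x) (y := val z)); rewrite // 1?perp_sym //.
  by apply: contraNneq nac => /val_inj ->.
case: s => [|a [|b [|c [|d [|f [|? s]]]]]] //= /andP[_ /andP[/= ce Us]];
  move: ce Us; rewrite /= ?andbT ?inE ?negb_or.
- case/and3P=> /andP[ab _] /andP[bc _] /andP[ca _].
  by case: a.1 b.1 c.1 ab bc ca => -[] [].
- case/and4P=> ab bc cd da /and3P[/and3P[_ nac _] /andP[_ nbd] _].
  by case/eqP: nbd; apply: (quad a b c d).
- case/and5P=> /andP[ab _] /andP[bc _] /andP[cd _] /andP[df _] /andP[fa _].
  by case: a.1 b.1 c.1 d.1 f.1 ab bc cd df fa => -[] [] [] [].
Qed.

Lemma card_hexagons v w : adj v w ->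
  #|[set s : 6.-tuple _ | [&& is_cycle adj s, nth v s 0 == v & nth v s 1 == w]]| =
  (q ^ 2 - q - 1) * ((q ^ 2 - q - 1) ^ 2 - (q ^ 3 - 3 * q - 2)).
Proof.
case: v w => b [x nx] [c [y ny]] /andP[/= bc xy].
have {bc}-> : c = ~~ b by case: b c bc => -[].
set v := (b, _); set w := (~~ b, _).
rewrite -(card_hexagon_data nx ny xy).
pose co (s : 6.-tuple (bool * {x | ~~ perp x x})) i := val (nth v s i).2.
pose f s := (co s 2, (co s 3, co s 5)).
(* A hexagon starting with [v, w] alternates sides, and its fifth vertex is the pole determined by
   the fourth and the sixth, so three coordinates suffice. *)
have hexP a2 a3 a4 a5 : is_cycle adj [:: v; w; a2; a3; a4; a5] ->
  [/\ [/\ a2.1 = b, a3.1 = ~~ b, a4.1 = b & a5.1 = ~~ b],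
      [/\ perp y (val a2.2), perp (val a2.2) (val a3.2) & perp (val a5.2) x],
      [/\ x != val a2.2, y != val a3.2 & y != val a5.2] &
      val a4.2 = pole (val a3.2) (val a5.2)].
  case: a2 a3 a4 a5 => [b2 x2] [b3 y3] [b4 x4] [b5 y5] /andP[_ /andP[]].
  rewrite /adj /= !andbT => /and5P[_ /andP[e2 p2] /andP[e3 p3] /andP[e4 p4]].
  case/andP=> /andP[e5 p5] /andP[e6 p6].
  have [-> -> -> ->] : [/\ b2 = b, b3 = ~~ b, b4 = b & b5 = ~~ b].
    by case: (b) b2 b3 b4 b5 e2 e3 e4 e5 e6 => -[] [] [] [].
  rewrite !inE !xpair_eqE !eqxx /= -!val_eqE /=.
  rewrite !negb_or; case/and5P=> /and5P[_ n2 _ n4 _] /and4P[_ n3 _ n5] _ /andP[_ n35] _.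
  split=> //; apply/esym/poleE => //; by rewrite // perp_sym.
have inj_f : {in [set s : 6.-tuple _ |
    [&& is_cycle adj s, nth v s 0 == v & nth v s 1 == w]] &, injective f}.
  move=> [[|a0 [|a1 [|a2 [|a3 [|a4 [|a5 []]]]]]] // ss].
  move=> [[|c0 [|c1 [|c2 [|c3 [|c4 [|c5 []]]]]]] // st].
  rewrite !inE /= => /and3P[Cs /eqP E0 /eqP E1] /and3P[Ct /eqP F0 /eqP F1].
  rewrite {}E0 {}E1 in ss Cs *; rewrite {}F0 {}F1 in st Ct *.
  have [[A2 A3 A4 A5] _ _ A] := hexP _ _ _ _ Cs.
  have [[C2 C3 C4 C5] _ _ C] := hexP _ _ _ _ Ct.
  rewrite /f /co /= => -[E2 E3 E5]; apply: val_inj => /=.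
  have E4 : val a4.2 = val c4.2 by rewrite A C; congr pole.
  have ext (a d : bool * {x | ~~ perp x x}) : a.1 = d.1 -> val a.2 = val d.2 -> a = d.
    by case: a d => ? ? [? ?] /= -> /val_inj ->.
  by congr [:: _; _; _; _; _; _]; apply: ext; rewrite // ?A2 ?A3 ?A4 ?A5.
rewrite -(card_in_imset inj_f); apply: eq_card => t.
apply/imsetP/idP=> [[]|].
  move=> [[|a0 [|a1 [|a2 [|a3 [|a4 [|a5 []]]]]]] // ss].
  rewrite inE /= => /and3P[Cs /eqP E0 /eqP E1] ->.
  rewrite {}E0 {}E1 in ss Cs *.
  have [_ [yx2 x2y3 y5x] [n2 n3 n5] A] := hexP _ _ _ _ Cs.
  rewrite !inE /= /co /= yx2 x2y3 perp_sym y5x -A.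
  by rewrite ![_ == x]eq_sym ![_ == y]eq_sym n2 n3 n5 (valP a2.2) (valP a3.2)
    (valP a4.2) (valP a5.2).
case: t => x2 [y3 y5]; rewrite !inE /=.
case/and3P=> /and3P[n2 yx2 a2] /andP[/and3P[n3 x2y3 a3] /and3P[n5 xy5 a5]] a4.
have [y34 y54] := poleP y3 y5.
have x2y : perp x2 y by rewrite perp_sym.
have nxx2 : x != x2 by rewrite eq_sym.
have n35 : y3 != y5.
  apply: contraNneq n5 => E; rewrite E in x2y3.
  by apply/eqP; apply: (pole_uniq nxx2).
pose V z (nz : ~~ perp z z) : {z | ~~ perp z z} := exist _ z nz.
exists [tuple v; w; (b, V _ a2); (~~ b, V _ a3); (b, V _ a4); (~~ b, V _ a5)] => //.
rewrite inE /= !eqxx !andbT /is_cycle /ucycleb /= /adj /= !inE !xpair_eqE !eqxx /=.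
have nbb : (b == ~~ b) = false by case: (b).
have nbb' : (~~ b == b) = false by case: (b).
rewrite -!val_eqE /= nbb nbb' /= xy yx2 x2y3 y34 (perp_sym _ y5) y54 (perp_sym y5) xy5 /=.
rewrite !orbF !negb_or nxx2 n35 !(eq_sym y) n3 n5 /= ?andbT.
(* It remains to separate [pole y3 y5] from [x] and [x2]: if they coincided, [y3] or [y5] would lie
   on the polars of both [x] and [x2], hence be [y]. *)
apply/andP; split.
  apply: contraNneq n3 => E; apply/eqP; apply: (pole_uniq nxx2) => //.
  by rewrite E perp_sym.
apply: contraNneq n5 => E; apply/eqP; apply: (pole_uniq nxx2) => //.
by rewrite E perp_sym.
Qed.

Lemma nonabsolute_graph_egr :
  is_egr adj (2 * (q ^ 4 - q ^ 3 + q ^ 2)) (q ^ 2 - q) 6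
    ((q ^ 2 - q - 1) * ((q ^ 2 - q - 1) ^ 2 - (q ^ 3 - 3 * q - 2))).
Proof.
have simple := nonabsolute_graph_simple.
split; first by split; [|exact: nonabsolute_graph_connected|exact: nonabsolute_graph_card].
split; [by nia | exact: nonabsolute_graph_regular | split |].
(* A 6-cycle exists because the graph has an edge and the number of hexagons through an edge is
   positive. *)
- have : 0 < #|{: bool * {x | ~~ perp x x}}|.
    by rewrite nonabsolute_graph_card; nia.
  case/card_gt0P=> v _.
  have : 0 < #|[set w | adj v w]|.
    by rewrite nonabsolute_graph_regular; nia.
  case/card_gt0P=> w; rewrite inE => vw.
  have := card_hexagons vw; set S := [set s | _] => ES.
  have : 0 < #|S|.
    rewrite ES muln_gt0; apply/andP; split; first by nia.
    rewrite subn_gt0; nia.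
  case/card_gt0P=> s; rewrite inE => /andP[Cs _].
  by exists s; rewrite ?size_tuple.
- exact: nonabsolute_graph_girth_ge.
- by move=> v w vw; rewrite (card_cycles_through_edge simple.1) card_hexagons.
Qed.

End UnitaryPolarity.

Import GRing.Theory Num.Theory.
Local Open Scope ring_scope.

(** * Traces, norms and the Hermitian polarity over a field of order q^2 *)

Lemma card_roots_le (F : finFieldType) (p : {poly F}) n :
  size p = n.+1 -> (#|[set x | root p x]| <= n)%N.
Proof.
move=> sp; rewrite cardE -ltnS -sp; apply: max_poly_roots.
- by rewrite -size_poly_eq0 sp.
- by apply/allP=> x; rewrite mem_enum inE.
- exact: enum_uniq.
Qed.

Section Hermitian.

Variables (F : finFieldType) (q : nat).
Hypothesis q_gt1 : (1 < q)%N.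
Hypothesis card_F : #|F| = (q ^ 2)%N.

Local Notation bar x := (x ^+ q).

(** This holds when [q] is a power of the characteristic; [bar] is then an involutory automorphism,
    since x^(q^2) = x in [F]. *)
Hypothesis barD : forall x y : F, bar (x + y) = bar x + bar y.

Let barK (x : F) : bar (bar x) = x.
Proof. by rewrite -exprM -[RHS]expf_card card_F -mulnn. Qed.

Let bar0 : bar (0 : F) = 0.
Proof. by rewrite expr0n; case: q q_gt1. Qed.

Let barN (x : F) : bar (- x) = - bar x.
Proof. by apply/eqP; rewrite -subr_eq0 opprK -barD addNr bar0. Qed.

Let barB (x y : F) : bar (x - y) = bar x - bar y.
Proof. by rewrite barD barN. Qed.

Let real_set := [set c : F | bar c == c].

Let card_real_le : (#|real_set| <= q)%N.
Proof.
have sp : size ('X^q - 'X : {poly F}) = q.+1.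
  by rewrite size_polyDl size_polyXn // size_polyN size_polyX.
rewrite (leq_trans _ (card_roots_le sp)) // subset_leq_card //.
by apply/subsetP=> x; rewrite !inE rootE !hornerE subr_eq0.
Qed.

(** The trace maps the q^2 elements of [F] to at most q fixed elements of [bar], and each fibre lies
    among the roots of a polynomial of degree q, so all fibres are full. *)
Lemma card_trace_eq (c : F) : bar c = c -> #|[set y : F | y + bar y == c]| = q.
Proof.
move=> cr.
have -> : [set y : F | y + bar y == c] = [set y in setT | y + bar y == c].
  by apply/setP=> y; rewrite !inE.
apply: (@card_fiber_eq _ _ setT real_set (fun y => y + bar y)).
- by move=> y _; rewrite inE barD barK addrC.
- by rewrite cardsT card_F -mulnn leq_mul2r card_real_le orbT.
- move=> b _.
  have sp : size ('X^q + ('X - b%:P) : {poly F}) = q.+1.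
    by rewrite size_polyDl size_polyXn // size_XsubC.
  rewrite (leq_trans _ (card_roots_le sp)) // subset_leq_card //.
  apply/subsetP=> x; rewrite !inE rootE !hornerE => /eqP <-.
  by rewrite -[_ == _]/(bar x + x - (x + bar x) == 0) (addrC _ x) subrr.
- by rewrite inE cr.
Qed.

(** Same argument on nonzero elements, with q^2 - 1 = (q - 1)(q + 1) and fibres in the roots of
    X^(q+1) - b. *)
Lemma card_norm_eq (c : F) :
  bar c = c -> c != 0 -> #|[set t : F | t * bar t == c]| = (q + 1)%N.
Proof.
move=> cr c0.
have -> : [set t : F | t * bar t == c] = [set t in ~: [set 0] | t * bar t == c].
  apply/setP=> t; rewrite !inE; have [->|//] := eqVneq t 0.
  by rewrite mul0r eq_sym (negbTE c0).
apply: (@card_fiber_eq _ _ _ (real_set :\ 0) (fun y => y * bar y)).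
- move=> t; rewrite !inE => t0.
  by rewrite mulf_neq0 ?expf_neq0 //= exprMn barK mulrC.
- have := cardsC1 (0 : F); rewrite card_F => ->.
  have := cardsD1 0 real_set; rewrite inE bar0 eqxx.
  move=> E; move: card_real_le; rewrite E add1n => ltq.
  have -> : (q ^ 2).-1 = (q.-1 * (q + 1))%N by nia.
  by rewrite leq_mul2r -ltnS prednK ?(ltnW q_gt1) // ltq orbT.
- move=> b _.
  have sp : size ('X^(q.+1) - b%:P : {poly F}) = q.+2.
    by rewrite size_XnsubC.
  rewrite addn1 (leq_trans _ (card_roots_le sp)) // subset_leq_card //.
  apply/subsetP=> x; rewrite !inE rootE !hornerE => /andP[_ /eqP <-].
  by rewrite exprS subrr.
- by rewrite !inE c0 cr eqxx.
Qed.

(* Some (inr (x, y)), Some (inl m) and None stand for the points (1, x, y),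
   (0, 1, m) and (0, 0, 1) in homogeneous coordinates (z, x, y), and hperp is
   orthogonality for the Hermitian form y z'^q + z y'^q - x x'^q. *)
Definition point : finType := option (F + F * F).

Definition hperp (u v : point) : bool :=
  match u, v with
  | Some (inr (a, b)), Some (inr (c, d)) => b + bar d == a * bar c
  | Some (inr (a, _)), Some (inl m) | Some (inl m), Some (inr (a, _)) => bar a == m
  | Some (inl _), None | None, Some (inl _) | None, None => true
  | _, _ => false
  end.

(** Exhibits the polar of the affine point [(a, b)] as the line of slope [bar a] and intercept
    [- bar b]. *)
Let hperp_affine (a b c d : F) : (b + bar d == a * bar c) = (d == c * bar a - bar b).
Proof.
apply/eqP/eqP=> [/(congr1 (fun x => bar x))|->].
  by rewrite barD exprMn !barK => E; rewrite mulrC -E; ring.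
by rewrite barB exprMn !barK; ring.
Qed.

Let bar_inj : injective (fun x : F => bar x).
Proof. by move=> x y E; rewrite -[x]barK E barK. Qed.

Lemma hperp_sym : symmetric hperp.
Proof.
move=> [[m|[a b]]|] [[m'|[c d]]|] //=.
by rewrite hperp_affine eq_sym subr_eq eq_sym.
Qed.

Lemma hperp_pole_exists u v : exists w, hperp u w /\ hperp v w.
Proof.
case: u v => [[m|[a b]]|] [[m'|[c d]]|]; do ?by exists None.
(* The polar of the infinite point [m] is the vertical line of abscissa [bar m]. *)
- exists (Some (inr (bar m, bar m * bar c - bar d))).
  by rewrite /= hperp_affine barK !eqxx.
- exists (Some (inr (bar m', bar m' * bar a - bar b))).
  by rewrite /= hperp_affine barK !eqxx.
(* Lines of equal slope meet at infinity; otherwise [x] is the abscissa of the intersection. *)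
- have [-> | nac] := eqVneq a c; first by exists (Some (inl (bar c))); rewrite /= eqxx.
  pose x := (bar b - bar d) / (bar a - bar c).
  exists (Some (inr (x, x * bar a - bar b))); rewrite /= !hperp_affine eqxx; split=> //.
  have nz : bar a - bar c != 0 by rewrite subr_eq0 (inj_eq bar_inj).
  by apply/eqP; rewrite /x; field.
- by exists (Some (inl (bar a))); rewrite /= eqxx.
- by exists (Some (inl (bar c))); rewrite /= eqxx.
Qed.

Lemma hperp_pole_uniq u v w z :
  u != v -> hperp u w -> hperp v w -> hperp u z -> hperp v z -> w = z.
Proof.
(* Two affine points whose polars share a slope and an affine point are equal. *)
have mixed (a b c d e f g : F) : Some (inr (a, b)) != Some (inr (c, d)) :> point ->
    e = f * bar a - bar b -> e = f * bar c - bar d -> bar a = g -> bar c = g -> False.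
  move=> + E1 E2 Ea Ec; have Eac : a = c by apply: bar_inj; rewrite Ea Ec.
  have -> : b = d.
    by apply: bar_inj; apply: oppr_inj; apply: (addrI (f * bar a)); rewrite -E1 E2 Eac.
  by rewrite Eac eqxx.
case: u v w z => [[m|[a b]]|] [[m'|[c d]]|] [[n|[x y]]|] [[n'|[x' y']]|] //=;
  rewrite ?hperp_affine.
- by move=> n0 /eqP E1 /eqP E2; move: n0; rewrite -E1 -E2 eqxx.
- by move=> n0 /eqP E1 /eqP E2; move: n0; rewrite -E1 -E2 eqxx.
- by move=> n0 _ _ /eqP E1 /eqP E2; move: n0; rewrite -E1 -E2 eqxx.
- by move=> _ /eqP E1 /eqP -> /eqP E2 /eqP ->; rewrite (bar_inj (etrans E1 (esym E2))).
- by move=> _ /eqP -> /eqP E1 /eqP -> /eqP E2; rewrite (bar_inj (etrans E1 (esym E2))).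
- by move=> _ /eqP <- _ /eqP <-.
- by move=> n0 /eqP E1 /eqP E2 /eqP E3 /eqP E4; case: (mixed _ _ _ _ _ _ _ n0 E3 E4 E1 E2).
- by move=> n0 /eqP E1 /eqP E2 /eqP E3 /eqP E4; case: (mixed _ _ _ _ _ _ _ n0 E1 E2 E3 E4).
- move=> n0 /eqP E1 /eqP E2 /eqP E3 /eqP E4.
  have nz : bar a - bar c != 0.
    rewrite subr_eq0 (inj_eq bar_inj); apply/eqP=> E.
    exact: (mixed _ _ _ _ _ _ (bar a) n0 E1 E2 erefl (esym (congr1 (fun x => bar x) E))).
  have E : x = x'.
    apply: (mulIf nz); rewrite !mulrBr.
    apply/eqP; rewrite subr_eq; apply/eqP.
    have -> : x * bar a = y + bar b by rewrite E1; ring.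
    have -> : x' * bar a = y' + bar b by rewrite E3; ring.
    have -> : x * bar c = y + bar d by rewrite E2; ring.
    have -> : x' * bar c = y' + bar d by rewrite E4; ring.
    by ring.
  by rewrite E1 E3 E.
- by move=> _ /eqP <- _ /eqP <-.
- by move=> _ _ /eqP <- _ /eqP <-.
Qed.

Lemma hperp_tangent_uniq u v : hperp u u -> hperp v v -> hperp u v -> u = v.
Proof.
case: u v => [[m|[a b]]|] [[m'|[c d]]|] //= /eqP E1 /eqP E2 /eqP E3.
have E4 : d + bar b = c * bar a.
  by rewrite -[d]barK -barD addrC E3 exprMn barK mulrC.
have Eac : a = c.
  (* The norm of [a - c] expands into the four values given by [E1] to [E4], which cancel. *)
  have : (a - c) * bar (a - c) = 0.
    rewrite barB mulrBr !mulrBl -E1 -E2 -E3 -E4; ring.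
  by move/eqP; rewrite mulf_eq0 expf_eq0 ltnW // orbb subr_eq0 => /eqP.
rewrite Eac in E1 E3 *; congr (Some (inr (_, _))).
by apply: bar_inj; apply: (addrI b); rewrite E1 E3.
Qed.

(** * Counting points on polars and absolute points *)

(** Parametrises the polar of [u] by a projective line over [F], so that counting on a polar becomes
    counting solutions of an equation in one field element, plus the point at [None]. *)
Definition polar_param (u : point) (o : option F) : point :=
  match u, o with
  | None, None => None
  | None, Some m => Some (inl m)
  | Some (inl m), None => None
  | Some (inl m), Some y => Some (inr (bar m, y))
  | Some (inr (a, b)), None => Some (inl (bar a))
  | Some (inr (a, b)), Some x => Some (inr (x, x * bar a - bar b))
  end.

Lemma polar_param_inj u : injective (polar_param u).
Proof. by case: u => [[m|[a b]]|] [x|] [y|] //= [->]. Qed.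

Lemma hperp_polar_param u v : hperp u v = (v \in codom (polar_param u)).
Proof.
apply/idP/codomP=> [|[o ->]].
  case: u v => [[m|[a b]]|] [[m'|[c d]]|] //=; rewrite ?hperp_affine.
  - by move=> /eqP <-; exists (Some d); rewrite /= barK.
  - by exists None.
  - by move/eqP=> <-; exists None.
  - by move/eqP=> ->; exists (Some c).
  - by exists (Some m').
  - by exists None.
by case: u o => [[m|[a b]]|] [o|] //=; rewrite ?hperp_affine ?barK eqxx.
Qed.

Lemma card_hperp_set u (D : pred point) :
  #|[set v | hperp u v & D v]| =
  (D (polar_param u None) + #|[set x | D (polar_param u (Some x))]|)%N.
Proof.
have -> : [set v | hperp u v & D v] =
    polar_param u @: [set o | D (polar_param u o)].
  apply/setP=> v; rewrite inE hperp_polar_param; apply/andP/imsetP.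
    by case=> /codomP[o ->] Dv; exists o; rewrite // inE.
  by case=> o; rewrite inE => Do ->; split=> //; apply: codom_f.
rewrite card_imset; last exact: polar_param_inj.
rewrite (cardsD1 None) inE; congr (_ + _)%N.
rewrite -[RHS](card_imset _ Some_inj); apply: eq_card => -[x|]; rewrite !inE.
  by rewrite mem_imset ?inE //; apply: Some_inj.
by apply/esym/imsetP=> -[].
Qed.

Lemma card_hperp_polar u : #|[set v | hperp u v]| = (q ^ 2 + 1)%N.
Proof.
have := card_hperp_set u predT.
have -> : [set v | hperp u v & predT v] = [set v | hperp u v].
  by apply/setP=> v; rewrite !inE andbT.
move=> ->; have -> : [set x : F | predT (polar_param u (Some x))] = setT.
  by apply/setP=> x; rewrite !inE.
by rewrite cardsT card_F addnC.
Qed.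

Lemma card_hperp_absolute_polar u :
  ~~ hperp u u -> #|[set v | hperp u v & hperp v v]| = (q + 1)%N.
Proof.
rewrite (card_hperp_set u (fun v => hperp v v)).
case: u => [[m|[a b]]|] //= nu.
  by rewrite addnC; congr (_ + 1)%N; rewrite card_trace_eq // exprMn barK mulrC.
(* Substituting x = t + a turns absoluteness into the norm equation [t * bar t = c], and [c] is
   nonzero because [u] is not absolute. *)
pose c := a * bar a - (b + bar b).
have cr : bar c = c by rewrite barB barD exprMn !barK /c; ring.
have c0 : c != 0 by rewrite subr_eq0 eq_sym.
rewrite -(card_norm_eq cr c0) add0n -[RHS](card_imset _ (addIr a)).
have barE x : bar (x * bar a - bar b) = a * bar x - b.
  by rewrite barB exprMn !barK mulrC.
apply: eq_card => x; rewrite inE /= barE; apply/eqP/imsetP => [E|[t]].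
  exists (x - a); rewrite ?subrK // inE barB mulrBr !mulrBl -E; apply/eqP.
  by rewrite /c; ring.
rewrite inE => /eqP tc ->; rewrite barD.
have -> : (t + a) * (bar t + bar a) = c + t * bar a + a * bar t + a * bar a.
  by rewrite -tc; ring.
by rewrite /c; ring.
Qed.

Lemma card_hperp_absolute : #|[set u | hperp u u]| = (q ^ 3 + 1)%N.
Proof.
pose E (x : F) := [set y : F | y + bar y == x * bar x].
have cardE x : x \in [set: F] -> #|E x| = q.
  by move=> _; rewrite card_trace_eq // exprMn barK mulrC.
(* [None] is the only absolute point at infinity, and each of the q^2 abscissas carries q affine
   ones, by the trace equation. *)
have -> : [set u | hperp u u] = None |: (fun t => Some (inr t)) @:
    [set t : F * F | (t.1 \in [set: F]) && (t.2 \in E t.1)].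
  apply/setP=> -[[m|[a b]]|]; rewrite !inE //=.
    by apply/esym/imsetP=> -[].
  by rewrite (mem_imset _ _ (f := fun t => Some (inr t))) ?inE // => ? ? [].
rewrite cardsU1 card_imset ?(card_dep_pairs cardE) ?cardsT ?card_F; last by move=> ? ? [].
have -> : None \notin (fun t : F * F => Some (inr t) : point) @:
    [set t : F * F | (t.1 \in [set: F]) && (t.2 \in E t.1)].
  by apply/imsetP=> -[].
by rewrite addnC -expnSr.
Qed.

Lemma card_point : #|point| = (q ^ 4 + q ^ 2 + 1)%N.
Proof. by rewrite card_option card_sum card_prod card_F; nia. Qed.
End Hermitian.

(** * Instantiation over the field of order q^2 *)

Theorem theorem2p6 (q : nat) (hq : (3 <= q)%N) (hpp : prime_power q) :
  exists n k lambda : nat,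
    [/\ n%:Z = 2 * (q%:Z ^+ 4 - q%:Z ^+ 3 + q%:Z ^+ 2),
        k%:Z = q%:Z ^+ 2 - q%:Z,
        lambda%:Z = (q%:Z ^+ 2 - q%:Z - 1) *
          (q%:Z ^+ 4 - 3 * q%:Z ^+ 3 - q%:Z ^+ 2 + 5 * q%:Z + 3) &
        exists (T : finType) (e : rel T),
          is_egr e n k 6 lambda /\ bipartite_graph e].
Proof.
exists (2 * (q ^ 4 - q ^ 3 + q ^ 2))%N, (q ^ 2 - q)%N.
exists ((q ^ 2 - q - 1) * ((q ^ 2 - q - 1) ^ 2 - (q ^ 3 - 3 * q - 2)))%N.
split.
- have le34 : (q ^ 3 <= q ^ 4)%N by rewrite leq_exp2l // (leq_trans _ hq).
  by rewrite PoszM PoszD -subzn // !rmorphXn.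
- by rewrite -subzn ?rmorphXn //; nia.
- have -> : (q ^ 3 - 3 * q - 2 = q ^ 3 - (3 * q + 2))%N by lia.
  (* Writing q = r + 3 gives each truncated difference as a polynomial in r with nonnegative
     coefficients, so that the identity over the integers reduces to [ring]. *)
  have [r ->] : exists r, q = (r + 3)%N by exists (q - 3)%N; lia.
  have -> : ((r + 3) ^ 2 - (r + 3) - 1 = r ^ 2 + 5 * r + 5)%N by nia.
  have -> : ((r + 3) ^ 3 - (3 * (r + 3) + 2) = r ^ 3 + 9 * r ^ 2 + 24 * r + 16)%N by nia.
  have -> : ((r ^ 2 + 5 * r + 5) ^ 2 - (r ^ 3 + 9 * r ^ 2 + 24 * r + 16) =
    r ^ 4 + 9 * r ^ 3 + 26 * r ^ 2 + 26 * r + 9)%N by nia.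
  by rewrite !(PoszM, PoszD, rmorphXn) /=; ring.
- have [p [m [pr_p m_gt0 Eq]]] := hpp.
  have m2_gt0 : (0 < m * 2)%N by rewrite muln_gt0 m_gt0.
  have [F pcharF] := pPrimePowerField pr_p m2_gt0.
  rewrite expnM -Eq => card_F.
  have barD (x y : F) : (x + y) ^+ q = x ^+ q + y ^+ q.
    by rewrite exprDn_pchar // Eq pnatX pnatE // pcharF.
  have q_gt1 : (1 < q)%N by rewrite (leq_trans _ hq).
  exists (bool * {x | ~~ @hperp F q x x})%type, (@nonabsolute_graph _ (@hperp F q)).
  split; last exact: nonabsolute_graph_bipartite.
  apply: nonabsolute_graph_egr => //.
  + exact: hperp_sym.
  + exact: hperp_pole_exists.
  + exact: hperp_pole_uniq.
  + exact: hperp_tangent_uniq.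
  + exact: card_hperp_polar.
  + exact: card_hperp_absolute_polar.
  + exact: card_point.
  + exact: card_hperp_absolute.
Qed.
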